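(* Suppose there exists an approximate radix-$15$ kernel $f\in\mathbb{R}[z]$, i.e. a polynomial with $(1-z)f(z) = 1 + O(z^{15})$, that can be evaluated at a square matrix with $4$ matrix products. Then the general radix-kernel iteration with this $f$ achieves coefficient $6/\log_2 15\approx 1.54$: for every $A\in\mathbb{R}^{d\times d}$ with spectral radius $\rho(A)<1$ and every $k = 15^t$ with $t\ge 1$ an integer, $t$ steps of the iteration use $6t = 6\log_{15}k = \frac{6}{\log_2 15}\log_2 k$ matrix products and produce a matrix $Y_t$ satisfying $$Y_t = \sum_{j=0}^{k-1}A^j + O(A^{k}).$$
   Context: The condition $(1-z)f(z)=1+O(z^{15})$ means that $z^{15}$ divides $(1-z)f(z)-1$ in $\mathbb{R}[z]$. The general radix-kernel iteration: with $M = I-A$, set $Y_0=I$, $R_0=A$, and for $n\ge 0$, $Y_{n+1} = Y_n\cdot f(R_n)$, $R_{n+1} = I - M\,Y_{n+1}$. Cost model: only matrix-matrix products are counted; linear combinations of matrices are free. A polynomial $f$ is evaluable with $p$ products if, starting from $I$ and $B$, one can obtain $f(B)$ for every square matrix $B$ by a fixed scheme that computes $p$ successive products, each factor being a fixed real linear combination of $I$, $B$ and previously computed products, with $f(B)$ a fixed linear combination of $I$, $B$ and the $p$ products. One step of the iteration is charged the products needed to evaluate $f(R_n)$, plus one product for $Y_n\cdot f(R_n)$, plus one product for $M\,Y_{n+1}$. An algorithm using $\gamma\log_2 k$ products to reach the first $k$ terms of the series $\sum_j A^j$ is said to have coefficient $\gamma$. The notation $O(A^k)$ is formal: a matrix of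 the form $A^kq(A)$ with $q\in\mathbb{R}[z]$ depending only on $f$ and $t$ (not on $A$ or $d$). *)

(* Defs.v *)
From HB Require Import structures.
From mathcomp Require Import all_boot all_order all_algebra.
From mathcomp Require Import classical_sets reals exp.
From mathcomp Require Import complex.

Set Implicit Arguments.
Unset Strict Implicit.
Unset Printing Implicit Defensive.

Import Order.TTheory GRing.Theory Num.Theory.
Local Open Scope ring_scope.

Definition log_base (R : realType) (b x : R) : R := ln x / ln b.

(* The eigenvalues are the complex ones.  They form a finite nonempty set, so
   the supremum of their moduli is a maximum. *)
Definition spectral_radius (R : realType) (d : nat) (A : 'M[R]_d.+1) : R :=
  sup [set complex.Re `|l| | l in
        [set l : R[i] | eigenvalue (map_mx (real_complex R) A) l]]%classic.

Definition approx_kernel (R : realType) (r : nat) (f : {poly R}) : Prop :=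
  'X^r %| (1 - 'X) * f - 1.

(* A value together with the number of matrix products spent computing it;
   [cmul] is the only operation that is charged. *)
Definition counted (T : Type) : Type := (T * nat)%type.

Definition cret (T : Type) (x : T) : counted T := (x, 0%N).

Definition cbind (T U : Type) (m : counted T) (k : T -> counted U) : counted U :=
  ((k m.1).1, (m.2 + (k m.1).2)%N).

Definition cmul (R : realType) (d : nat) (A B : 'M[R]_d.+1) :
  counted 'M[R]_d.+1 := (A * B, 1%N).

(* Missing coefficients are 0; coefficients beyond [size v] are ignored. *)
Definition lincomb (R : realType) (d : nat) (c : seq R)
    (v : seq 'M[R]_d.+1) : 'M[R]_d.+1 :=
  \sum_(i < size v) c`_i *: v`_i.

(* The i-th entry of [factors] holds the coefficients of the left and right
   factors of the i-th product, with respect to I, B and the previous products,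
   in this order. *)
Record scheme (R : realType) := Scheme {
  factors : seq (seq R * seq R);
  output : seq R
}.

Definition nproducts (R : realType) (S : scheme R) : nat := size (factors S).

Fixpoint run_products (R : realType) (d : nat) (ps : seq (seq R * seq R))
    (v : seq 'M[R]_d.+1) : counted (seq 'M[R]_d.+1) :=
  if ps is (l, r) :: ps' then
    cbind (cmul (lincomb l v) (lincomb r v))
          (fun P => run_products ps' (rcons v P))
  else cret v.

Definition run_scheme (R : realType) (S : scheme R) (d : nat)
    (B : 'M[R]_d.+1) : counted 'M[R]_d.+1 :=
  cbind (run_products (factors S) [:: 1; B])
        (fun v => cret (lincomb (output S) v)).

Definition evaluates (R : realType) (S : scheme R) (f : {poly R}) : Prop :=
  forall (d : nat) (B : 'M[R]_d.+1), (run_scheme S B).1 = horner_mx B f.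

Definition evaluable_with (R : realType) (p : nat) (f : {poly R}) : Prop :=
  exists S : scheme R, nproducts S = p /\ evaluates S f.

(* The pair (Y_n, R_n). *)
Fixpoint radix_iter (R : realType) (f : {poly R}) (d : nat)
    (A : 'M[R]_d.+1) (n : nat) : 'M[R]_d.+1 * 'M[R]_d.+1 :=
  if n is n'.+1 then
    let YR := radix_iter f A n' in
    let Y := YR.1 * horner_mx YR.2 f in
    (Y, 1 - (1 - A) * Y)
  else (1, A).

(* The same iteration, with f(R_n) computed by the scheme S and all products
   counted. *)
Fixpoint counted_radix_iter (R : realType) (S : scheme R) (d : nat)
    (A : 'M[R]_d.+1) (n : nat) : counted ('M[R]_d.+1 * 'M[R]_d.+1) :=
  if n is n'.+1 then
    cbind (counted_radix_iter S A n') (fun YR =>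
    cbind (run_scheme S YR.2) (fun F =>
    cbind (cmul YR.1 F) (fun Y =>
    cbind (cmul (1 - A) Y) (fun MY =>
    cret (Y, 1 - MY)))))
  else cret (1, A).

Definition radix_algorithm (R : realType) (S : scheme R) (t d : nat)
    (A : 'M[R]_d.+1) : counted 'M[R]_d.+1 :=
  cbind (counted_radix_iter S A t) (fun YR => cret YR.1).

(* Y(A) = sum_(j < k) A^j + O(A^k) for all A of spectral radius < 1, in every
   dimension; the remainder polynomial q does not depend on A or d. *)
Definition reaches_terms (R : realType) (k : nat)
    (Y : forall d : nat, 'M[R]_d.+1 -> 'M[R]_d.+1) : Prop :=
  exists q : {poly R}, forall (d : nat) (A : 'M[R]_d.+1),
    spectral_radius A < 1 ->
    Y d A = \sum_(0 <= j < k) A ^+ j + A ^+ k * horner_mx A q.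

(* [alg t] is the algorithm run for t steps, which is to reach the first r ^ t
   terms of the series. *)
Definition achieves_coefficient (R : realType) (gamma : R) (r : nat)
    (alg : forall t d : nat, 'M[R]_d.+1 -> counted 'M[R]_d.+1) : Prop :=
  forall t k : nat, (1 <= t)%N -> k = (r ^ t)%N ->
    reaches_terms k (fun d A => (alg t d A).1) /\
    forall (d : nat) (A : 'M[R]_d.+1), spectral_radius A < 1 ->
      (alg t d A).2%:R = gamma * log_base 2 k%:R.

(* Main.v *)
Require Import Defs.
From HB Require Import structures.
From mathcomp Require Import all_boot all_order all_algebra.
From mathcomp Require Import classical_sets reals exp.
From mathcomp Require Import complex.
From mathcomp Require Import ring lra.

(** Every matrix the iteration produces is a polynomial in [A], so the analysis
    takes place in [R[z]]: let [P n] be the polynomial with [Y_n = P n (A)]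
    ([iter_poly]) and [rho n = 1 - (1 - z) P n] the one with [R_n = rho n (A)]
    ([residual_poly], [radix_iterE]).  Substituting [rho n] for [z] in the
    kernel condition [(1 - z) f = 1 + O(z^r)] and using
    [1 - rho n = (1 - z) P n] gives [rho n.+1 = O(rho n ^ r)].  Since
    [rho 0 = z], the order of vanishing at [0] is multiplied by at least [r] at
    each step, and [rho n = O(z^(r^n))] ([residual_poly_dvd]).

    It follows that [(1 - z) P n] and
    [(1 - z) (1 + z + ... + z^(r^n - 1)) = 1 - z^(r^n)] agree modulo [z^(r^n)].
    As [1 - z] is coprime to [z], it can be cancelled, so [P n] is the
    truncated geometric series up to a multiple of [z^(r^n)]
    ([geometric_of_residual]).  Evaluating at [A] gives the remainder
    [A^k q(A)], with a [q] read off from [P n] alone.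

    A step costs [p] products for [f(R_n)] and two more, so [t] steps cost
    [(p + 2) t], and [t = log_r k] turns this into
    [(p + 2) / log_2 r * log_2 k].  Here [r = 15] and [p = 4].  The decimal
    value of [6 / log_2 15] comes from rational bounds on [log_2 15]
    certified by comparing powers of [2] and [15]. *)

Set Implicit Arguments.
Unset Strict Implicit.
Unset Printing Implicit Defensive.

Import Order.TTheory GRing.Theory Num.Theory.
Local Open Scope ring_scope.

(** * The iteration as a sequence of polynomials *)

Fixpoint iter_poly (R : realType) (f : {poly R}) (n : nat) : {poly R} :=
  if n is n'.+1 then
    iter_poly f n' * (f \Po (1 - (1 - 'X) * iter_poly f n'))
  else 1.

Definition residual_poly (R : realType) (f : {poly R}) (n : nat) : {poly R} :=
  1 - (1 - 'X) * iter_poly f n.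

Lemma horner_mx_comp (R : realType) (d : nat) (A : 'M[R]_d.+1)
    (p q : {poly R}) :
  horner_mx A (p \Po q) = horner_mx (horner_mx A q) p.
Proof.
elim/poly_ind: p => [|p c IHp]; first by rewrite comp_poly0 !rmorph0.
rewrite comp_polyD comp_polyM comp_polyX comp_polyC !rmorphD !rmorphM /= IHp.
by rewrite horner_mx_X !horner_mx_C.
Qed.

Lemma rmorph_residual (T U : nzRingType) (phi : {rmorphism T -> U}) (x y : T) :
  phi (1 - (1 - x) * y) = 1 - (1 - phi x) * phi y.
Proof. by rewrite rmorphB rmorphM rmorphB rmorph1. Qed.

Lemma horner_mx_residual (R : realType) (d : nat) (A : 'M[R]_d.+1)
    (P : {poly R}) :
  horner_mx A (1 - (1 - 'X) * P) = 1 - (1 - A) * horner_mx A P.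
Proof.
rewrite (rmorph_residual (horner_mx A)).
by congr (1 - (1 - _) * _); exact: horner_mx_X.
Qed.

Lemma radix_iterE (R : realType) (f : {poly R}) (d : nat) (A : 'M[R]_d.+1)
    (n : nat) :
  radix_iter f A n =
    (horner_mx A (iter_poly f n), horner_mx A (residual_poly f n)).
Proof.
rewrite /residual_poly horner_mx_residual; elim: n => [|n IHn].
  by rewrite [iter_poly f 0]/= rmorph1 mulr1 subKr.
have -> : horner_mx A (iter_poly f n.+1) =
          horner_mx A (iter_poly f n) * horner_mx (radix_iter f A n).2 f.
  rewrite IHn -horner_mx_residual -horner_mx_comp.
  exact: (rmorphM (horner_mx A)).
by rewrite [LHS]/= IHn.
Qed.

(** With [rho] the residual, composing the kernel condition with [rho] gives
    [rho^r %| (1 - rho) (f \Po rho) - 1], and since [1 - rho] is [1 - 'X] times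
    the current iterate, the right-hand side is minus the next residual. *)
Lemma residual_poly_dvd (R : realType) (r : nat) (f : {poly R}) (n : nat) :
  approx_kernel r f -> 'X^(r ^ n) %| residual_poly f n.
Proof.
move=> f_kernel; elim: n => [|n IHn].
  by rewrite /residual_poly /= mulr1 subKr.
have step : residual_poly f n ^+ r %| residual_poly f n.+1.
  have := dvdp_comp_poly (residual_poly f n) f_kernel.
  rewrite comp_Xn_poly !(comp_polyB, comp_polyM) comp_polyX -polyC1.
  rewrite !comp_polyC polyC1.
  have -> : 1 - residual_poly f n = (1 - 'X) * iter_poly f n by rewrite subKr.
  by rewrite -mulrA -dvdpNr opprB.
by rewrite expnSr exprM; apply: dvdp_trans (dvdp_exp2r _ IHn) step.
Qed.

(** Both [P] and the geometric sum become [1] modulo ['X^k] when multiplied by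
    [1 - 'X], and [1 - 'X] is invertible modulo ['X^k]. *)
Lemma geometric_of_residual (R : realType) (k : nat) (P : {poly R}) :
  'X^k %| 1 - (1 - 'X) * P ->
  exists q : {poly R}, P = \sum_(0 <= j < k) 'X^j + 'X^k * q.
Proof.
move=> resP.
have coX : coprimep 'X^k (1 - 'X : {poly R}).
  rewrite -opprB -scaleN1r coprimepZr ?oppr_eq0 ?oner_eq0 //.
  apply: coprimep_expl.
  by rewrite -polyC1 coprimep_XsubC rootX oner_eq0.
have geo : (1 - 'X) * \sum_(0 <= j < k) 'X^j = 1 - 'X^k :> {poly R}.
  by rewrite big_mkord -(opprB 'X 1) mulNr -subrX1 opprB.
have : 'X^k %| (1 - 'X) * (P - \sum_(0 <= j < k) 'X^j).
  have -> : (1 - 'X) * (P - \sum_(0 <= j < k) 'X^j) =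
            'X^k - (1 - (1 - 'X) * P) by rewrite mulrBr geo; ring.
  by rewrite dvdp_sub.
rewrite Gauss_dvdpr // => /dvdpP[q qE]; exists q.
by rewrite mulrC -qE addrC subrK.
Qed.

Lemma radix_iter_terms (R : realType) (r : nat) (f : {poly R}) (n : nat) :
  approx_kernel r f ->
  exists q : {poly R}, forall (d : nat) (A : 'M[R]_d.+1),
    (radix_iter f A n).1 =
      \sum_(0 <= j < r ^ n) A ^+ j + A ^+ (r ^ n) * horner_mx A q.
Proof.
move=> /(residual_poly_dvd n)/geometric_of_residual[q PE]; exists q => d A.
rewrite radix_iterE /= PE rmorphD rmorphM rmorph_sum rmorphXn /= horner_mx_X.
by congr (_ + _); apply: eq_bigr => j _; rewrite rmorphXn /= horner_mx_X.
Qed.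

(** * Counting products *)

Lemma run_products_count (R : realType) (d : nat) (ps : seq (seq R * seq R))
    (v : seq 'M[R]_d.+1) :
  (run_products ps v).2 = size ps.
Proof. by elim: ps v => [|[l r] ps IHps] v //=; rewrite IHps. Qed.

Lemma run_schemeE (R : realType) (S : scheme R) (f : {poly R}) (d : nat)
    (B : 'M[R]_d.+1) :
  evaluates S f -> run_scheme S B = (horner_mx B f, nproducts S).
Proof.
move=> Sf; rewrite -Sf /run_scheme /cbind /cret /= run_products_count.
by rewrite addn0.
Qed.

Lemma counted_radix_iterE (R : realType) (S : scheme R) (f : {poly R})
    (d : nat) (A : 'M[R]_d.+1) (t : nat) :
  evaluates S f ->
  counted_radix_iter S A t = (radix_iter f A t, ((nproducts S).+2 * t)%N).
Proof.
move=> Sf; elim: t => [|t IHt]; first by rewrite /= muln0.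
cbn [counted_radix_iter]; rewrite IHt /cbind (run_schemeE _ Sf) /=.
by rewrite mulnS addn0 addn2 addnC.
Qed.

(** * Logarithms *)

Lemma log_base_nat_exp (R : realType) (b r t : nat) :
  (0 < r)%N ->
  log_base b%:R (r ^ t)%:R = t%:R * log_base b%:R r%:R :> R.
Proof.
by move=> r0; rewrite /log_base natrX lnXn ?ltr0n // mulr_natl mulrnAl.
Qed.

Lemma log_base_self (R : realType) (b : R) : 1 < b -> log_base b b = 1.
Proof. by move=> b1; rewrite /log_base divff // gt_eqF // ln_gt0. Qed.

Lemma log_base_gt0 (R : realType) (b x : R) :
  1 < b -> 1 < x -> 0 < log_base b x.
Proof. by move=> b1 x1; rewrite divr_gt0 ?ln_gt0. Qed.

Lemma log_base_lt_frac (R : realType) (b x : R) (m n : nat) :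
  1 < b -> 0 < x -> (0 < n)%N -> x ^+ n < b ^+ m ->
  log_base b x < m%:R / n%:R.
Proof.
move=> b1 x0 n0 xb; have b0 : 0 < b := lt_trans ltr01 b1.
rewrite ltr_pdivrMr ?ln_gt0 // mulrAC ltr_pdivlMr ?ltr0n //.
by rewrite mulr_natr mulr_natl -!lnXn // ltr_ln ?posrE ?exprn_gt0.
Qed.

Lemma log_base_gt_frac (R : realType) (b x : R) (m n : nat) :
  1 < b -> 0 < x -> (0 < n)%N -> b ^+ m < x ^+ n ->
  m%:R / n%:R < log_base b x.
Proof.
move=> b1 x0 n0 bx; have b0 : 0 < b := lt_trans ltr01 b1.
rewrite ltr_pdivlMr ?ln_gt0 // mulrAC ltr_pdivrMr ?ltr0n //.
by rewrite mulr_natr mulr_natl -!lnXn // ltr_ln ?posrE ?exprn_gt0.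
Qed.

(** The tolerance amounts to roughly [3.8835 < log_2 15 < 3.9088], and
    [log_2 15 = 3.90689...].  The convergent [39/10] is sharp enough on the
    left; on the right [43/11 = 3.909...] just misses, and [168/43] is the
    combination of these two with a small enough denominator to be checked by
    comparing powers. *)
Lemma six_over_log2_15 (R : realType) :
  `|6 / log_base 2 15 - 154 / 100| < 5 / 1000 :> R.
Proof.
have two_gt1 : 1 < 2 :> R by lra.
have fifteen_gt0 : 0 < 15 :> R by lra.
have lo : 39%:R / 10%:R < log_base 2 15 :> R.
  by apply: log_base_gt_frac => //; lra.
have hi : log_base 2 15 < 168%:R / 43%:R :> R.
  by apply: log_base_lt_frac => //; lra.
have L0 : 0 < log_base 2 15 :> R by apply: lt_trans lo; lra.
rewrite ltr_distl ltr_pdivlMr // ltr_pdivrMr //.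
by apply/andP; split; lra.
Qed.

(** * The coefficient of a radix kernel *)

(** From [log_2 k = t log_2 r] for [k = r^t]; the condition [1 < r] makes
    [log_2 r] invertible. *)
Lemma cost_log2 (R : realType) (c r t : nat) :
  (1 < r)%N ->
  (c * t)%:R = c%:R / log_base 2 r%:R * log_base 2 (r ^ t)%:R :> R.
Proof.
move=> r1; have L0 : log_base 2 r%:R != 0 :> R.
  by rewrite gt_eqF // log_base_gt0 ?ltr1n.
rewrite (log_base_nat_exp R 2) ?(ltnW r1) // natrM.
by rewrite mulrACA mulVf // mulr1.
Qed.

Lemma kernel_achieves_coefficient (R : realType) (r p : nat) (f : {poly R})
    (S : scheme R) :
  (1 < r)%N -> approx_kernel r f -> nproducts S = p -> evaluates S f ->
  achieves_coefficient (p.+2%:R / log_base 2 r%:R) r (radix_algorithm S).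
Proof.
move=> r1 f_kernel Sp Sf t k _ ->; rewrite /radix_algorithm; split.
  have [q qE] := radix_iter_terms t f_kernel; exists q => d A _.
  by rewrite /= (counted_radix_iterE _ _ Sf) /= qE.
move=> d A _; rewrite /= (counted_radix_iterE _ _ Sf) /= Sp addn0.
exact: cost_log2.
Qed.

Theorem corollary5p10 (R : realType) (f : {poly R})
    (f_kernel : approx_kernel 15 f) (f_eval : evaluable_with 4 f) :
  (forall S : scheme R, nproducts S = 4%N -> evaluates S f ->
     achieves_coefficient (6 / log_base 2 15) 15 (radix_algorithm S)) /\
  `|6 / log_base 2 15 - 154 / 100| < 5 / 1000 :> R /\
  (forall t k : nat, (1 <= t)%N -> k = (15 ^ t)%N ->
     (forall S : scheme R, nproducts S = 4%N -> evaluates S f ->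
        forall (d : nat) (A : 'M[R]_d.+1), spectral_radius A < 1 ->
          counted_radix_iter S A t = (radix_iter f A t, (6 * t)%N)) /\
     (6 * t)%:R = 6 * log_base 15 k%:R :> R /\
     6 * log_base 15 k%:R = 6 / log_base 2 15 * log_base 2 k%:R :> R /\
     exists q : {poly R}, forall (d : nat) (A : 'M[R]_d.+1),
       spectral_radius A < 1 ->
       (radix_iter f A t).1 =
         \sum_(0 <= j < k) A ^+ j + A ^+ k * horner_mx A q).
Proof.
split=> [S S4 Sf|]; first exact: kernel_achieves_coefficient Sf.
split=> [|t k _ ->]; first exact: six_over_log2_15.
have log15 : (6 * t)%:R = 6 * log_base 15 (15 ^ t)%:R :> R.
  rewrite (log_base_nat_exp R 15) // log_base_self; last by rewrite ltr1n.
  by rewrite mulr1 natrM.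
split=> [S S4 Sf d A _|]; first by rewrite (counted_radix_iterE _ _ Sf) S4.
split=> //; split; first by rewrite -log15; exact: (cost_log2 R 6).
have [q qE] := radix_iter_terms t f_kernel.
by exists q => d A _; exact: qE.
Qed.
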